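(* Let $p$ be a prime, $n\ge1$, $q=p^n$, and let $0\le s\le q$ be an integer divisible by $p$. Then there exist a monic $p$-linearized divisor $L$ of $x^q-x$ and $f\in\mathbb{F}_q[x]$ such that $P(x)=f(L(x))+x$ is a permutation of $\mathbb{F}_q$ that decomposes into $s$ cycles of length $1$ and $\frac{q-s}{p}$ cycles of length $p$.
   Context: A $p$-linearized polynomial is a polynomial of the form $\sum_{i=0}^m a_i x^{p^i}$; here $L\in\mathbb{F}_q[x]$. *)

(* Defs.v *)
From mathcomp Require Import all_boot all_order all_algebra all_fingroup.

Set Implicit Arguments.
Unset Strict Implicit.
Unset Printing Implicit Defensive.

Import GRing.Theory.
Local Open Scope ring_scope.

Definition linearized (R : nzRingType) (p : nat) (L : {poly R}) : Prop :=
  exists (m : nat) (a : nat -> R), L = \sum_(i < m.+1) a i *: 'X^(p ^ i).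

(* The permutation of T induced by the self-map P has cycles of lengths 1 and
   d only, exactly s of the former and t of the latter.  Fixed points count as
   cycles: they are the singleton orbits in porbits.  The counts are separate
   only for d != 1. *)
Definition permutes_with_cycles (T : finType) (P : T -> T) (d s t : nat) :
    Prop :=
  exists sigma : {perm T},
    [/\ forall x, sigma x = P x,
        forall C, C \in porbits sigma -> #|C| = 1%N \/ #|C| = d,
        #|[set C in porbits sigma | #|C| == 1%N]| = s
      & #|[set C in porbits sigma | #|C| == d]| = t].

(* Main.v *)
Require Import Defs.
From mathcomp Require Import all_boot all_order all_algebra all_fingroup.
From mathcomp Require Import cyclic finfield.

Set Implicit Arguments.
Unset Strict Implicit.
Unset Printing Implicit Defensive.

Import GRing.Theory.
Local Open Scope ring_scope.

(** Take L = X^p - X.  It is additive with kernel the prime field F_p, so its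
fibres are the cosets of F_p, all of size p, and there are q / p of them.
Choose a set A of s / p values of L and, since every function on a finite field
is a polynomial, choose f vanishing on A and equal to 1 off A.  Then
P(x) = x + f(L(x)) moves each point inside its own coset, by a step that depends
on the coset only: P is the identity on the s points of the fibres over A, and
the translation by 1, which is a p-cycle, on every other coset.

The cycle count needs no description of the cycles themselves: P has p-th power
the identity, so its orbits have size 1 or p ([prime_exponent_cycles]), and it
suffices to count the fixed points ([card_preimset_uniform] applied to the
fibres of L, whose size is given by [card_artin_schreier_fibre]). *)

(** Orbit sizes divide the order of the permutation, hence are 1 or p.  The
singleton orbits correspond to the fixed points, and summing the sizes of all
orbits then determines the number of p-cycles. *)
Lemma prime_exponent_cycles (T : finType) (p : nat) (sigma : {perm T}) :
  prime p -> (sigma ^+ p = 1)%g ->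
  permutes_with_cycles sigma p #|[set x | sigma x == x]|
    ((#|T| - #|[set x | sigma x == x]|) %/ p)%N.
Proof.
move=> p_prime sigmap; exists sigma.
have p_gt1 := prime_gt1 p_prime.
have sizeP C : C \in porbits sigma -> #|C| = 1%N \/ #|C| = p.
  case/imsetP=> x _ ->; rewrite porbitE.
  have orb_dvd : (#|orbit 'P <[sigma]>%g x| %| p)%N.
    by apply: dvdn_trans (dvdn_orbit _ _ _) _; rewrite -orderE order_dvdn sigmap.
  have [->|orb_neq1] := eqVneq #|orbit 'P <[sigma]>%g x| 1%N; first by left.
  by right; apply/(prime_nt_dvdP p_prime orb_neq1).
have fixed_eq : [set C in porbits sigma | #|C| == 1%N]
    = [set [set x] | x in [set x | sigma x == x]].
  apply/setP=> C; rewrite inE; apply/andP/imsetP.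
    case=> /imsetP[x _ ->] /cards1P[y orb_y].
    have /set1P xy : x \in [set y] by rewrite -orb_y porbit_id.
    exists x; last by rewrite orb_y xy.
    rewrite inE -in_set1 xy -orb_y -xy.
    by have := mem_porbit sigma 1 x; rewrite expg1.
  case=> x; rewrite inE => /eqP fix_x ->; rewrite cards1; split=> //.
  apply/imsetP; exists x => //; apply/setP=> y; rewrite inE.
  apply/eqP/porbitP=> [->|[i ->]]; first by exists 0%N; rewrite expg0 perm1.
  by rewrite permX; elim: i => //= i ->.
have card1 : #|[set C in porbits sigma | #|C| == 1%N]|
    = #|[set x | sigma x == x]|.
  by rewrite fixed_eq card_imset //; apply: set1_inj.
split=> //.
have orbits_partition : partition (porbits sigma) [set: T].
  have -> : porbits sigma = [set orbit 'P <[sigma]>%g x | x in [set: T]].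
    apply/setP=> C; apply/imsetP/imsetP=> -[x _ ->]; exists x;
      by rewrite ?inE ?porbitE.
  by apply: orbit_partition; apply/actsP=> a _ x; rewrite !inE.
have cardT : #|T| = (#|[set x | sigma x == x]|
    + #|[set C in porbits sigma | #|C| == p]| * p)%N.
  rewrite -cardsT (card_partition orbits_partition).
  rewrite (bigID (fun C : {set T} => #|C| == 1%N)) /=; congr (_ + _)%N.
    rewrite -card1 -sum1_card; apply: eq_big => [C|C /andP[_ /eqP]//].
    by rewrite inE.
  rewrite -sum_nat_const; apply: eq_big => [C|C /andP[orbC C_neq1]].
    rewrite inE; case orbC: (C \in porbits sigma) => //=.
    by case: (sizeP C orbC) => ->; rewrite eqxx ?(ltn_eqF p_gt1) ?gtn_eqF.
  by case: (sizeP C orbC) C_neq1 => -> //; rewrite eqxx.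
by rewrite cardT addKn mulnK // prime_gt0.
Qed.

Lemma card_preimset_uniform (T U : finType) (f : T -> U) (m : nat)
    (A : {set U}) :
  A \subset f @: [set: T] ->
  (forall x, #|[set y | f y == f x]| = m) ->
  #|f @^-1: A| = (#|A| * m)%N.
Proof.
move=> /subsetP A_im fibre.
rewrite -sum1_card (partition_big f (mem A)) /= => [|x]; last by rewrite inE.
rewrite -sum_nat_const; apply: eq_bigr => a aA.
have /imsetP[x _ a_def] := A_im a aA.
rewrite -(fibre x) -sum1_card; apply: eq_bigl => y.
by rewrite !inE -a_def; case: eqP => [->|]; rewrite ?aA ?andbF.
Qed.

(** [X^p - X] has at most p roots, and the p elements of the prime field are
roots. *)
Lemma card_frobenius_fixed (F : finFieldType) (p : nat) :
  p \in [pchar F] -> #|[set z : F | z ^+ p == z]| = p.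
Proof.
move=> pcharFp; have p_prime := pcharf_prime pcharFp.
have p_gt1 := prime_gt1 p_prime.
apply/eqP; rewrite eqn_leq; apply/andP; split.
  have size_p : size ('X^p - 'X : {poly F}) = p.+1.
    by rewrite size_polyDl ?size_polyXn // size_polyN size_polyX ltnS.
  have p_neq0 : 'X^p - 'X != 0 :> {poly F} by rewrite -size_poly_eq0 size_p.
  rewrite cardE -ltnS -size_p; apply: max_poly_roots => //; last exact: enum_uniq.
  apply/allP=> z; rewrite mem_enum inE => /eqP zp.
  by rewrite rootE !hornerE zp subrr.
have natr_inj : injective (fun i : 'I_p => i%:R : F).
  have le_inj (i j : 'I_p) : (i <= j)%N -> i%:R = j%:R :> F -> i = j.
    move=> le_ij eq_ij; apply/val_inj/eqP; rewrite eqn_leq le_ij /= -subn_eq0.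
    have : (p %| j - i)%N by rewrite (dvdn_pcharf pcharFp) natrB // eq_ij subrr.
    by case: posnP => [->//|ij_gt0] /(dvdn_leq ij_gt0); rewrite leqNgt
       (leq_ltn_trans (leq_subr _ _) (ltn_ord j)).
  move=> i j; case/orP: (leq_total i j) => [/le_inj//|le_ji eq_ij].
  by apply/esym/le_inj.
rewrite -[leqLHS]card_ord -(card_imset predT natr_inj) subset_leq_card //.
apply/subsetP=> _ /imsetP[i _ ->]; rewrite inE.
by rewrite -(pFrobenius_autE pcharFp) pFrobenius_aut_nat.
Qed.

(** The fibre through x is the coset of x modulo the kernel of the additive map
[x |-> x ^+ p - x]. *)
Lemma card_artin_schreier_fibre (F : finFieldType) (p : nat) (x : F) :
  p \in [pchar F] -> #|[set y : F | y ^+ p - y == x ^+ p - x]| = p.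
Proof.
move=> pcharFp; rewrite -[RHS](card_frobenius_fixed pcharFp).
rewrite -[RHS](card_imset _ (addrI x)); apply: eq_card => y.
apply/idP/imsetP => [|[z]]; rewrite !inE.
  move=> /eqP eq_xy; exists (y - x); last by rewrite addrC subrK.
  rewrite inE -(pFrobenius_autE pcharFp) rmorphB /= !pFrobenius_autE.
  by rewrite -(subrK y (y ^+ p)) eq_xy addrAC [x ^+ p - x]addrC addrK addrC.
move=> /eqP zp ->; rewrite -(pFrobenius_autE pcharFp) rmorphD /=.
by rewrite !pFrobenius_autE zp [x + z]addrC opprD addrA addrK.
Qed.

(** Modulo [X^p - X] one has [X^p = X], hence [X^(p^n) = X] by iteration. *)
Lemma artin_schreier_dvdp (F : fieldType) (p n : nat) :
  ('X^p - 'X : {poly F}) %| 'X^(p ^ n) - 'X.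
Proof.
elim: n => [|n IHn]; first by rewrite expn0 expr1 subrr dvdp0.
(* X^(p^(n+1)) - X^p is divisible by X^(p^n) - X, as a difference of p-th
   powers. *)
rewrite -(subrK 'X^p 'X^(p ^ n.+1)) -addrA dvdp_addl ?dvdpp //.
by rewrite expnSr exprM subrXX dvdp_mulr.
Qed.

(** The power #|F| - 1 sends every nonzero value to 1, so raising to it turns
any polynomial with zero set A into the indicator of the complement of A. *)
Lemma indicator_poly (F : finFieldType) (A : {set F}) :
  exists f : {poly F}, forall y, f.[y] = (y \notin A)%:R.
Proof.
exists ((\prod_(a in A) ('X - a%:P)) ^+ #|F|.-1) => y.
rewrite horner_exp horner_prod; have [yA|yNA] /= := boolP (y \in A).
  rewrite (bigD1 y) //= !hornerE subrr mul0r expr0n.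
  by rewrite -subn1 subn_eq0 leqNgt finNzRing_gt1.
set c := (\prod_(a in A) _); suff c_neq0 : c != 0.
  apply: (mulIf c_neq0); rewrite -exprSr prednK ?expf_card ?mul1r //.
  exact: ltnW (finNzRing_gt1 _).
apply/prodf_neq0 => a aA; rewrite hornerXsubC subr_eq0.
by apply: contraNneq yNA => ->.
Qed.

Theorem corollary5p7 (p n s : nat) (F : finFieldType)
    (p_prime : prime p) (n_ge1 : (1 <= n)%N) (cardF : #|F| = (p ^ n)%N)
    (s_le_q : (s <= p ^ n)%N) (p_dvd_s : (p %| s)%N) :
  exists L f : {poly F},
    [/\ L \is monic,
        linearized p L,
        L %| 'X^(p ^ n) - 'X
      & permutes_with_cycles (fun x : F => (f \Po L + 'X).[x])
          p s ((p ^ n - s) %/ p)%N].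
Proof.
have pcharFp : p \in [pchar F] := card_finPcharP cardF p_prime.
have p_gt1 := prime_gt1 p_prime; have p_gt0 := prime_gt0 p_prime.
pose l (x : F) := x ^+ p - x.
have fibre x : #|[set y | l y == l x]| = p by apply: card_artin_schreier_fibre.
(* Counting F itself by the fibres of l shows that l has q / p values. *)
have card_im : (#|l @: [set: F]| * p = p ^ n)%N.
  rewrite -cardF -(card_preimset_uniform (subxx _) fibre) -cardsT.
  by congr #|pred_of_set _|; apply/setP=> x; rewrite !inE imset_f.
have [A A_im cardA] : exists2 A : {set F}, A \subset l @: [set: F]
    & #|A| = (s %/ p)%N.
  have : (0 < #|[set A : {set F} |
             (A \subset l @: [set: F]) && (#|A| == s %/ p)]|)%N.
    by rewrite cards_draws bin_gt0 leq_divLR // card_im.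
  by case/card_gt0P=> A; rewrite inE => /andP[A_im /eqP cardA]; exists A.
have [f f_val] := indicator_poly A.
pose P (x : F) := x + (l x \notin A)%:R.
have lP x : l (P x) = l x.
  rewrite /l /P -!(pFrobenius_autE pcharFp) rmorphD /= pFrobenius_aut_nat.
  by rewrite opprD addrACA subrr addr0.
(* If P x = P y, then l x = l y, so x and y are moved by the same step. *)
have P_inj : injective P.
  by move=> x y eq_Pxy; have := eq_Pxy; rewrite /P -(lP x) eq_Pxy lP => /addIr.
exists ('X^p - 'X), f; split.
- by rewrite monicE lead_coefDl ?lead_coefXn // size_polyN size_polyX
    size_polyXn ltnS.
- exists 1%N, (fun i => if i == 0%N then -1 else 1).
  by rewrite !big_ord_recl big_ord0 /= expn0 expn1 expr1 addr0 scaleN1r scale1r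
    addrC.
- exact: artin_schreier_dvdp.
pose sigma := perm P_inj.
have iterP k x : (sigma ^+ k)%g x = x + (l x \notin A)%:R *+ k.
  have l_iter i : l (iter i P x) = l x by elim: i => //= i; rewrite lP.
  rewrite permX; elim: k => [|k IHk] /=; first by rewrite addr0.
  rewrite permE {1}/P; have -> : iter k sigma x = iter k P x.
    by apply: eq_iter => y; rewrite permE.
  by rewrite l_iter -(eq_iter (permE P_inj)) IHk -addrA mulrSr.
(* Iterating adds the same step each time, and p steps add up to 0. *)
have sigmap : (sigma ^+ p = 1)%g.
  apply/permP=> x; rewrite iterP perm1 -mulr_natr (pcharf0 pcharFp).
  by rewrite mulr0 addr0.
have fixedP : #|[set x | sigma x == x]| = s.
  rewrite -(divnK p_dvd_s) -cardA -(card_preimset_uniform A_im fibre).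
  apply: eq_card => x; rewrite !inE permE /P -subr_eq0 addrC addKr.
  by case: (l x \in A); rewrite ?eqxx ?oner_eq0.
have := prime_exponent_cycles p_prime sigmap; rewrite fixedP cardF.
case=> tau [tauE tau_size tau1 taup]; exists tau; split=> // x.
by rewrite tauE permE hornerD horner_comp !hornerE f_val addrC.
Qed.
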